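(* Let $p$ be a path consisting of a chain of cells with a single bottleneck, with the mixed-autonomy cell-transmission flow dynamics described in the context. If $p$ is at Path Equilibrium, then all cells of the path have the same autonomy level; denote it $\alpha_p$. If the vehicle flow demand on the path is strictly less than the minimum cell capacity, the path has no congested cells. Otherwise, the path has one of the following latencies, where $\gamma_p\in\{0,1,2,\ldots,m^{\mathrm n}_p\}$: $$\ell_p=\frac{|\mathcal I_p|}{\bar v_p}+\gamma_p\,\frac{(1-r_p)\,\bar n^{\mathrm n}_p\,\bigl(\alpha_p h^{\mathrm a}_p+(1-\alpha_p)h^{\mathrm h}_p\bigr)}{r_p\,\bar v_p\,b^{\mathrm n}_p}.$$
   Context: Path. A path $p$ is a finite chain of cells $\mathcal I_p$, indexed increasingly from upstream to downstream (cell $i+1$ is immediately downstream of cell $i$), not shared with other paths; vehicles leave the last cell into a cell of infinite capacity. The first $m^{\mathrm n}_p$ cells (nonbottleneck cells) each have $b^{\mathrm n}_p$ lanes and jam density $\bar n^{\mathrm n}_p$; the remaining $m^{\mathrm b}_p$ cells (bottleneck cells) each have $b^{\mathrm b}_p<b^{\mathrm n}_p$ lanes and jam density $\bar n^{\mathrm b}_p$. Put $r_p=b^{\mathrm b}_p/b^{\mathrm n}_p\in(0,1)$. All cells of the path share the free-flow velocity $\bar v_p$ (cells per time step) and nominal headways $h^{\mathrm h}_p$ (human-driven) and $h^{\mathrm a}_p$ (autonomous), in cells per vehicle. Cell quantities. Cell $i$ has continuous densities $n^{\mathrm h}_i,n^{\mathrm a}_i\ge 0$ of human-driven and autonomous vehicles,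 $n_i=n^{\mathrm h}_i+n^{\mathrm a}_i$, and autonomy level $\alpha_i=n^{\mathrm a}_i/(n^{\mathrm h}_i+n^{\mathrm a}_i)$. With $b_i$ its number of lanes and $\bar n_i$ its jam density (the density at which flow stops completely), its critical density is $\tilde n_i(\alpha_i)=b_i/(\alpha_i h^{\mathrm a}_p+(1-\alpha_i)h^{\mathrm h}_p)$ (less than $\bar n_i$), its capacity is $\bar F_i(\alpha_i)=\bar v_p\,\tilde n_i(\alpha_i)$, and its shockwave speed is $w_i(\alpha_i)=\bar v_p\tilde n_i(\alpha_i)/(\bar n_i-\tilde n_i(\alpha_i))$. A cell is congested if $n_i>\tilde n_i(\alpha_i)$. Flow dynamics. The sending function is $S_i=\min(\bar F_i(\alpha_i),\bar v_p n_i)$ and the receiving function is $R_i=\min(\bar F_i(\alpha_i),(\bar n_i-n_i)w_i(\alpha_i))$. The total flow from cell $i$ to cell $i+1$ is $f_i=\min(S_i,R_{i+1})$; the flow out of the last cell $i$ is $f_i=S_i$. The human and autonomous outflows are $f^{\mathrm h}_i=(1-\alpha_i)f_i$, $f^{\mathrm a}_i=\alpha_i f_i$. With $y^{\mathrm h}_i,y^{\mathrm a}_i$ the flows into cell $i$ (the outflows of the preceding cell, or for the first cell the entering demand, limited by the receiving function), densities update by $n^{\mathrm h}_i(k+1)=n^{\mathrm h}_i(k)+y^{\mathrm h}_i(k)-f^{\mathrm h}_i(k)$ and $n^{\mathrm a}_i(k+1)=n^{\mathrm a}_i(k)+y^{\mathrm a}_i(k)-f^{\mathrm a}_i(k)$.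 Path Equilibrium. A set of cell densities $(n^{\mathrm h}_i,n^{\mathrm a}_i)_{i\in\mathcal I_p}$ such that, for a given constant human and autonomous flow (the demand) entering the first cell, the cell densities are constant in time. The vehicle flow demand is the total of these entering flows. Latency. At equilibrium the latency of cell $i$ is $n_i/f_i$, and the latency of the path is $\ell_p=\sum_{i\in\mathcal I_p} n_i/f_i$.
   Formalization: When the demand exactly equals the minimum cell capacity, the latency formula is stated only for equilibria in which each cell's flow is min(S_i, R_i), i.e. no cell is partially queued; otherwise the latency can take values between the listed ones. *)

(* Defs.v *)
From mathcomp Require Import all_boot all_order all_algebra.

Set Implicit Arguments.
Unset Strict Implicit.
Unset Printing Implicit Defensive.
Import Order.TTheory GRing.Theory Num.Theory.
Local Open Scope ring_scope.

(* Suffixes: _n nonbottleneck / _b bottleneck cells, _h human-driven /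
   _a autonomous vehicles. Headways are in cells per vehicle, the free-flow
   velocity in cells per time step. *)
Record bpath (R : realFieldType) := BPath {
  m_n : nat;
  m_b : nat;
  lanes_n : nat;
  lanes_b : nat;
  jam_n : R;
  jam_b : R;
  vbar : R;
  hw_h : R;
  hw_a : R
}.

Definition ncells (R : realFieldType) (p : bpath R) : nat := (m_n p + m_b p)%N.

Section Cells.
Variables (R : realFieldType) (p : bpath R).
Local Notation cell := 'I_(ncells p).

Definition mean_headway (a : R) : R := a * hw_a p + (1 - a) * hw_h p.

Definition lane_ratio : R := (lanes_b p)%:R / (lanes_n p)%:R.

(* Cells are indexed from upstream to downstream. *)
Definition lanes (i : cell) : R :=
  if (i < m_n p)%N then (lanes_n p)%:R else (lanes_b p)%:R.

Definition jam (i : cell) : R := if (i < m_n p)%N then jam_n p else jam_b p.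

Definition crit (i : cell) (a : R) : R := lanes i / mean_headway a.

Definition capacity (i : cell) (a : R) : R := vbar p * crit i a.

Definition shockwave (i : cell) (a : R) : R :=
  vbar p * crit i a / (jam i - crit i a).

Definition valid_path : Prop :=
  [/\ (0 < m_b p)%N,
      (0 < lanes_b p < lanes_n p)%N,
      0 < vbar p,
      0 < hw_h p /\ 0 < hw_a p
    & forall (i : cell) (a : R), 0 <= a <= 1 -> crit i a < jam i].

Record state := State { dens_h : cell -> R; dens_a : cell -> R }.

Definition dens (s : state) (i : cell) : R := dens_h s i + dens_a s i.

(* An empty cell gets autonomy level 0, as 0 / 0 = 0. *)
Definition autonomy (s : state) (i : cell) : R := dens_a s i / dens s i.

Definition congested (s : state) (i : cell) : bool :=
  crit i (autonomy s i) < dens s i.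

Definition sending (s : state) (i : cell) : R :=
  Num.min (capacity i (autonomy s i)) (vbar p * dens s i).

Definition receiving (s : state) (i : cell) : R :=
  Num.min (capacity i (autonomy s i))
          ((jam i - dens s i) * shockwave i (autonomy s i)).

(* ordS and ord_pred wrap around; the guards in flow, inflow_h and inflow_a
   keep them within the chain. *)
Definition flow (s : state) (i : cell) : R :=
  if (i.+1 < ncells p)%N then Num.min (sending s i) (receiving s (ordS i))
  else sending s i.

Definition outflow_h (s : state) (i : cell) : R :=
  (1 - autonomy s i) * flow s i.
Definition outflow_a (s : state) (i : cell) : R := autonomy s i * flow s i.

(* The entering demand (d_h, d_a) is limited by the receiving function of the
   first cell, both vehicle types being reduced in the same proportion. *)
Definition inflow_h (d_h d_a : R) (s : state) (i : cell) : R :=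
  if i == 0%N :> nat
  then d_h / (d_h + d_a) * Num.min (d_h + d_a) (receiving s i)
  else outflow_h s (ord_pred i).
Definition inflow_a (d_h d_a : R) (s : state) (i : cell) : R :=
  if i == 0%N :> nat
  then d_a / (d_h + d_a) * Num.min (d_h + d_a) (receiving s i)
  else outflow_a s (ord_pred i).

Definition trajectory (d_h d_a : R) (x : nat -> state) : Prop :=
  forall (k : nat) (i : cell),
    dens_h (x k.+1) i
      = dens_h (x k) i + inflow_h d_h d_a (x k) i - outflow_h (x k) i
    /\
    dens_a (x k.+1) i
      = dens_a (x k) i + inflow_a d_h d_a (x k) i - outflow_a (x k) i.

Definition path_equilibrium (d_h d_a : R) (s : state) : Prop :=
  (forall i, 0 <= dens_h s i /\ 0 <= dens_a s i)
  /\ trajectory d_h d_a (fun=> s).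

(* The head of the sequence is only a neutral element for the idempotent min;
   the sequence is nonempty since valid_path implies 0 < ncells p. *)
Definition min_capacity (s : state) : R :=
  let F := [seq capacity i (autonomy s i) | i : cell] in
  \big[Num.min/head 0 F]_(c <- F) c.

Definition latency (s : state) : R := \sum_(i : cell) dens s i / flow s i.

(* Each cell lies on its triangular flow-density curve. In an equilibrium at
   exactly the bottleneck capacity this excludes a queue whose tail lies
   strictly inside a cell: such a cell can have any density between its
   free-flow and queued values, while its outflow is set by the next cell. *)
Definition on_fundamental_diagram (s : state) : Prop :=
  forall i : cell, flow s i = Num.min (sending s i) (receiving s i).

End Cells.

(* Main.v *)
Require Import Defs.
From mathcomp Require Import all_boot all_order all_algebra.
From mathcomp Require Import ring lra.
Set Implicit Arguments.
Unset Strict Implicit.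
Unset Printing Implicit Defensive.

Import Order.TTheory GRing.Theory Num.Theory.
Local Open Scope ring_scope.

(** At an equilibrium every cell passes on exactly what it receives, so one
    flow q crosses the whole path ([flow_const]); as each vehicle type is
    conserved separately, the autonomy level is also the same everywhere
    ([autonomy_const]).  If q = 0 all cells are empty, hence have the same
    autonomy level by convention.

    The main tool is [light_traffic]: if q is less than every capacity, free
    flow propagates upstream from the exit.  Indeed the last cell can only be
    limited by its own density, and an uncongested cell receives at full
    capacity, more than q, so it does not limit the cell before it.  Since q
    is at most the demand, a demand below the minimum capacity leaves no
    congested cell ([light_demand]).

    For a demand at or above the minimum capacity, q equals that capacity
    ([flow_saturated]): with a smaller q, [light_traffic] would let the first
    cell admit more than q.  Now every cell has sending function q or
    receiving function q ([cell_on_diagram]).  A demand above the capacity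
    makes the receiving function of the first cell equal to q, and this
    spreads downstream ([excess_demand_receiving]); for a demand equal to the
    capacity the claim is a case of [on_fundamental_diagram].

    A cell sending q holds the density q / vbar ([free_latency]).  A cell that
    could send more is a nonbottleneck cell holding a queue: its density lies
    on the congested branch of its flow-density curve at height q, which, as q
    is the bottleneck capacity [flow_bottleneck], gives a latency exceeding
    1 / vbar by a constant ([queued_latency]).  The number gamma counts these
    cells. *)

(** * Induction along a chain of cells *)

Lemma val_ord_pred (n : nat) (i : 'I_n) :
  (0 < i)%N -> ord_pred i = i.-1 :> nat.
Proof.
case: n i => [[//]|n] [[//|i] lt_i] _.
by rewrite -[LHS]/((i + n.+1) %% n.+1)%N modnDr modn_small // ltnW.
Qed.

Lemma val_ordS (n : nat) (i : 'I_n) : (i.+1 < n)%N -> ordS i = i.+1 :> nat.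
Proof. by move=> lt_i /=; rewrite modn_small. Qed.

Lemma downstream_ind (n : nat) (P : 'I_n -> Prop) :
  (forall i : 'I_n, ((0 < i)%N -> P (ord_pred i)) -> P i) ->
  forall i : 'I_n, P i.
Proof.
move=> step i; have [k] := ubnP (i : nat); elim: k i => // k IH i lt_ik.
apply: step => i_gt0; apply: IH; rewrite val_ord_pred //.
by rewrite prednK.
Qed.

Lemma upstream_ind (n : nat) (P : 'I_n -> Prop) :
  (forall i : 'I_n, ((i.+1 < n)%N -> P (ordS i)) -> P i) ->
  forall i : 'I_n, P i.
Proof.
move=> step i; have [k] := ubnP (n - i)%N; elim: k i => // k IH i lt_ik.
apply: step => lt_i; apply: IH; rewrite val_ordS //.
by rewrite -ltnS subnSK // ltnW.
Qed.

(** * The triangular flow-density curve of a cell *)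

Section Cell.
Variables (R : realFieldType) (p : bpath R) (s : state p).
Local Notation cell := 'I_(ncells p).
Hypotheses (hp : valid_path p)
  (dens_ge0_ha : forall i, 0 <= dens_h s i /\ 0 <= dens_a s i).

Lemma vbar_gt0 : 0 < vbar p.
Proof. by case: hp. Qed.

Lemma dens_ge0 (i : cell) : 0 <= dens s i.
Proof. by case: (dens_ge0_ha i) => ? ?; apply: addr_ge0. Qed.

Lemma autonomy_itv (i : cell) : 0 <= autonomy s i <= 1.
Proof.
have [h_ge0 a_ge0] := dens_ge0_ha i.
rewrite divr_ge0 ?dens_ge0 //=.
have := dens_ge0 i; rewrite le_eqVlt => /orP[/eqP n0|n_gt0].
  by rewrite /autonomy -n0 invr0 mulr0 ler01.
by rewrite ler_pdivrMr // mul1r /dens lerDr.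
Qed.

Lemma mean_headway_gt0 a : 0 <= a <= 1 -> 0 < mean_headway p a.
Proof.
case: hp => _ _ _ [h_gt0 a_gt0] _ /andP[ge0 le1].
rewrite /mean_headway; have [->|lt1] := eqVneq a 1.
  by rewrite subrr mul0r addr0 mul1r.
apply: ltr_wpDl; first by rewrite mulr_ge0 // ltW.
by rewrite mulr_gt0 // subr_gt0 lt_neqAle lt1.
Qed.

Lemma capacity_gt0 (i : cell) : 0 < capacity i (autonomy s i).
Proof.
have [_ /andP[b_gt0 b_lt] _ _ _] := hp.
rewrite mulr_gt0 ?vbar_gt0 // divr_gt0 ?mean_headway_gt0 ?autonomy_itv //.
by rewrite /lanes; case: ifP; rewrite ltr0n // (ltn_trans b_gt0).
Qed.

(** The congested branch of the curve falls linearly from the capacity, at the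
    critical density, to 0 at the jam density. *)
Lemma receiving_lt_capacity (i : cell) :
  (receiving s i < capacity i (autonomy s i)) = congested s i.
Proof.
have [_ _ _ _ /(_ i _ (autonomy_itv i)) crit_lt] := hp.
rewrite /receiving gt_min ltxx /= /shockwave -/(capacity i _) /congested.
rewrite mulrA ltr_pdivrMr ?subr_gt0 // [ltRHS]mulrC.
by rewrite ltr_pM2r ?capacity_gt0 // ltrD2l ltrN2.
Qed.

Lemma receiving_le_capacity (i : cell) :
  receiving s i <= capacity i (autonomy s i).
Proof. by rewrite ge_min lexx. Qed.

Lemma receiving_uncongested (i : cell) :
  ~~ congested s i -> receiving s i = capacity i (autonomy s i).
Proof.
rewrite -receiving_lt_capacity -leNgt => le_cr.
by apply/le_anti; rewrite le_cr receiving_le_capacity.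
Qed.

Lemma sending_le_capacity (i : cell) : sending s i <= capacity i (autonomy s i).
Proof. by rewrite ge_min lexx. Qed.

Lemma sending_lt_capacity (i : cell) :
  sending s i < capacity i (autonomy s i) ->
  vbar p * dens s i = sending s i /\ ~~ congested s i.
Proof.
rewrite /sending gt_min ltxx /= => lt_n.
split; first by rewrite min_r // ltW.
by rewrite -leNgt -(ler_pM2l vbar_gt0) ltW.
Qed.

Lemma ncells_gt0 : (0 < ncells p)%N.
Proof. by case: hp => mb_gt0 _ _ _ _; rewrite addn_gt0 mb_gt0 orbT. Qed.

(** The head that starts the minimum is itself the capacity of a cell because
    the path is not empty. *)
Lemma min_capacity_attained :
  exists i, min_capacity s = capacity i (autonomy s i).
Proof.
rewrite /min_capacity big_map.
apply: (big_ind (fun c => exists i, c = capacity i (autonomy s i))).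
- rewrite /image_mem; case E: (enum _) => [|j e]; last by exists j.
  by have := mem_enum 'I_(ncells p) (Ordinal ncells_gt0); rewrite E.
- by move=> _ _ [i ->] [j ->]; rewrite minEle; case: ifP; [exists i|exists j].
- by move=> i _; exists i.
Qed.

Lemma min_capacity_gt0 : 0 < min_capacity s.
Proof. by have [i ->] := min_capacity_attained; apply: capacity_gt0. Qed.

Lemma min_capacity_le (i : cell) : min_capacity s <= capacity i (autonomy s i).
Proof. by apply: ge_bigmin_seq => //; apply: map_f; rewrite mem_enum. Qed.

End Cell.

(** * Conservation laws at equilibrium *)

Section Equilibrium.
Variables (R : realFieldType) (p : bpath R) (d_h d_a : R) (s : state p).
Local Notation cell := 'I_(ncells p).
Hypotheses (hp : valid_path p) (heq : path_equilibrium d_h d_a s).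

Let dens_ha := heq.1.

Lemma inflow_outflow (i : cell) :
  inflow_h d_h d_a s i = outflow_h s i /\ inflow_a d_h d_a s i = outflow_a s i.
Proof. by case: heq => _ /(_ 0%N i) [] /=; lra. Qed.

Lemma outflow_total (i : cell) : outflow_h s i + outflow_a s i = flow s i.
Proof. by rewrite /outflow_h /outflow_a; ring. Qed.

Lemma flow_pred (i : cell) : (0 < i)%N -> flow s i = flow s (ord_pred i).
Proof.
move=> i_gt0; rewrite -!outflow_total; have [<- <-] := inflow_outflow i.
by rewrite /inflow_h /inflow_a gtn_eqF.
Qed.

Lemma autonomy_flow_pred (i : cell) : (0 < i)%N ->
  autonomy s i * flow s i = autonomy s (ord_pred i) * flow s (ord_pred i).
Proof.
move=> i_gt0; have [_] := inflow_outflow i.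
by rewrite /inflow_a gtn_eqF.
Qed.

Lemma flow_const : exists q, forall i, flow s i = q.
Proof.
exists (flow s (Ordinal (ncells_gt0 hp))); apply: downstream_ind => i IH.
have [i_gt0|] := ltnP 0 i; first by rewrite flow_pred // IH.
by rewrite leqn0 => /eqP i0; congr flow; apply: val_inj.
Qed.

Variable q : R.
Hypothesis flow_q : forall i, flow s i = q.

(** The proportions of the two vehicle types in the entering flow add up to 1
    as soon as there is a demand. *)
Lemma flow_first (i : cell) : i = 0%N :> nat -> d_h + d_a != 0 ->
  q = Num.min (d_h + d_a) (receiving s i).
Proof.
move=> i0 d_neq0; rewrite -(flow_q i) -outflow_total.
have [<- <-] := inflow_outflow i.
by rewrite /inflow_h /inflow_a i0 eqxx -mulrDl -mulrDl divff // mul1r.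
Qed.

(** The demand 0 is treated apart, since then the proportions of the entering
    flow are 0 / 0. *)
Lemma flow_le_demand : q <= d_h + d_a.
Proof.
have [d0|d_neq0] := eqVneq (d_h + d_a) 0; last first.
  by rewrite (@flow_first (Ordinal (ncells_gt0 hp))) // ge_min lexx.
rewrite -(flow_q (Ordinal (ncells_gt0 hp))) -outflow_total d0.
have [<- <-] := inflow_outflow (Ordinal (ncells_gt0 hp)).
by rewrite /inflow_h /inflow_a /= d0 invr0 !mulr0 !mul0r addr0.
Qed.

Lemma flow_le_sending (i : cell) : q <= sending s i.
Proof. by rewrite -(flow_q i) /flow; case: ifP => // _; rewrite ge_min lexx. Qed.

Lemma flow_le_receiving (i : cell) : d_h + d_a != 0 -> q <= receiving s i.
Proof.
move=> d_neq0; have [i_gt0|] := ltnP 0 i; last first.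
  by rewrite leqn0 => /eqP i0; rewrite (@flow_first i) // ge_min lexx orbT.
rewrite -(flow_q (ord_pred i)) /flow val_ord_pred // prednK // ltn_ord.
by rewrite ord_predK ge_min lexx orbT.
Qed.

(** * Flow below capacity *)

(** Going upstream from the exit, a cell is never limited by the next one: that
    one is uncongested, so it could receive its capacity, which exceeds q. *)
Lemma light_traffic : (forall i, q < capacity i (autonomy s i)) ->
  forall i, vbar p * dens s i = q /\ ~~ congested s i.
Proof.
move=> lt_cap; apply: upstream_ind => i IH.
suff Si : sending s i = q.
  by have := sending_lt_capacity hp (s := s) (i := i); rewrite Si; apply.
have := flow_q i; rewrite /flow; case: ifP => // lt_i.
have [_ /receiving_uncongested->//] := IH lt_i.
have := lt_cap (ordS i); rewrite minEle; case: ifP => // _ /[swap] ->.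
by rewrite ltxx.
Qed.

(** With a nonzero flow, conservation of autonomous vehicles forces the same
    autonomy level in neighbouring cells.  With no flow all cells are empty by
    [light_traffic], and an empty cell has autonomy level 0 / 0 = 0. *)
Lemma autonomy_const i j : autonomy s i = autonomy s j.
Proof.
have [q0|q_neq0] := eqVneq q 0.
  suff aut0 k : autonomy s k = 0 by rewrite !aut0.
  have [|+ _] := @light_traffic _ k.
    by move=> l; rewrite q0 capacity_gt0.
  move/eqP; rewrite q0 mulf_eq0 gt_eqF ?vbar_gt0 //= /autonomy => /eqP->.
  by rewrite invr0 mulr0.
suff H k : autonomy s k = autonomy s (Ordinal (ncells_gt0 hp)) by rewrite !H.
elim/downstream_ind: k => k IH; have [k_gt0|] := ltnP 0 k.
  rewrite -IH //; apply: (mulIf q_neq0).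
  by have := autonomy_flow_pred k_gt0; rewrite !flow_q.
by rewrite leqn0 => /eqP k0; congr autonomy; apply: val_inj.
Qed.

Lemma light_demand : d_h + d_a < min_capacity s ->
  forall i, ~~ congested s i.
Proof.
move=> lt_d i; apply: (@light_traffic _ i).2 => j.
apply: le_lt_trans flow_le_demand (lt_le_trans lt_d _).
exact: min_capacity_le.
Qed.

(** * Flow at capacity *)

Section Saturated.
Hypothesis le_d : min_capacity s <= d_h + d_a.

Lemma demand_neq0 : d_h + d_a != 0.
Proof. by rewrite gt_eqF // (lt_le_trans _ le_d) // (min_capacity_gt0 hp heq.1). Qed.

(** Were q smaller, [light_traffic] would make the first cell ready to receive
    its capacity, so that the demand or this capacity, both above q, would
    enter the path. *)
Lemma flow_saturated : q = min_capacity s.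
Proof.
apply: le_anti; apply/andP; split.
  have [i ->] := min_capacity_attained s hp.
  exact: le_trans (flow_le_sending i) (sending_le_capacity _ _).
rewrite leNgt; apply/negP => lt_q.
have lt_cap i : q < capacity i (autonomy s i).
  by apply: lt_le_trans lt_q (min_capacity_le _ _).
pose i0 := Ordinal (ncells_gt0 hp).
have := @flow_first i0 erefl demand_neq0.
rewrite receiving_uncongested //; last exact: (light_traffic lt_cap i0).2.
have : q < Num.min (d_h + d_a) (capacity i0 (autonomy s i0)).
  by rewrite lt_min lt_cap (lt_le_trans lt_q).
by move=> /[swap] <-; rewrite ltxx.
Qed.

(** Lanes can only disappear when going downstream. *)
Lemma capacity_pred (i : cell) : (0 < i)%N ->
  capacity i (autonomy s i)
    <= capacity (ord_pred i) (autonomy s (ord_pred i)).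
Proof.
have [_ /andP[b_gt0 b_lt] _ _ _] := hp.
move=> i_gt0; rewrite (autonomy_const (ord_pred i) i).
rewrite /capacity ler_pM2l ?vbar_gt0 // /crit ler_pM2r; last first.
  by rewrite invr_gt0 mean_headway_gt0 // autonomy_itv.
rewrite /lanes val_ord_pred //; case: ltnP => [lt_i|le_i].
  by rewrite (leq_ltn_trans (leq_pred i)).
by case: ifP => // _; rewrite ler_nat ltnW.
Qed.

(** The first cell throttles the demand, so it receives q.  If a cell could
    receive more than q, the cell before it would have to be limited by its own
    sending function, hence be in free flow; it could then receive its capacity,
    which exceeds q, contrary to the induction hypothesis. *)
Lemma excess_demand_receiving : min_capacity s < d_h + d_a ->
  forall i, receiving s i = q.
Proof.
move=> lt_d; apply: downstream_ind => i IH.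
have q_le := flow_le_receiving i demand_neq0.
have [i_gt0|] := ltnP 0 i; last first.
  rewrite leqn0 => /eqP i0; have := @flow_first i i0 demand_neq0.
  rewrite minEle; case: ifP => // _ qd.
  by move: lt_d; rewrite -qd -flow_saturated ltxx.
apply/eqP; rewrite eq_le q_le andbT leNgt; apply/negP => lt_q.
have lt_cap : q < capacity (ord_pred i) (autonomy s (ord_pred i)).
  apply: lt_le_trans (capacity_pred i_gt0).
  by apply: lt_le_trans lt_q (receiving_le_capacity _ _).
have S_pred : sending s (ord_pred i) = q.
  have := flow_q (ord_pred i).
  rewrite /flow val_ord_pred // prednK // ltn_ord ord_predK minEle.
  by case: ifP => // _ Ri; move: lt_q; rewrite Ri ltxx.
have [|_ /receiving_uncongested Rp] :=
  sending_lt_capacity hp (s := s) (i := ord_pred i).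
  by rewrite S_pred.
by move: lt_cap; rewrite -Rp // IH // ltxx.
Qed.

Hypothesis diagram : d_h + d_a = min_capacity s -> on_fundamental_diagram s.

Lemma cell_on_diagram (i : cell) : sending s i = q \/ receiving s i = q.
Proof.
have [/diagram/(_ i)|neq_d] := eqVneq (d_h + d_a) (min_capacity s).
  by rewrite flow_q minEle; case: ifP => _ ->; [left|right].
by right; apply: excess_demand_receiving; rewrite lt_neqAle eq_sym neq_d.
Qed.

Variable alpha : R.
Hypothesis autonomy_alpha : forall i, autonomy s i = alpha.

(** The extra density (1 - r) jam of a queued cell, divided by the bottleneck
    capacity vbar * lanes_b / headway. *)
Let queue_delay : R :=
  (1 - lane_ratio p) * jam_n p * mean_headway p alpha
  / (lane_ratio p * vbar p * (lanes_n p)%:R).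

Lemma alpha_itv : 0 <= alpha <= 1.
Proof.
by rewrite -(autonomy_alpha (Ordinal (ncells_gt0 hp))) autonomy_itv.
Qed.

Lemma flow_bottleneck : q = vbar p * ((lanes_b p)%:R / mean_headway p alpha).
Proof.
have [mb_gt0 /andP[b_gt0 b_lt] _ _ _] := hp.
have cap i : capacity i (autonomy s i)
    = vbar p * (lanes i / mean_headway p alpha).
  by rewrite autonomy_alpha.
have h_gt0 : 0 < (mean_headway p alpha)^-1.
  by rewrite invr_gt0 mean_headway_gt0 // alpha_itv.
have lt_last : ((ncells p).-1 < ncells p)%N by rewrite prednK ?ncells_gt0.
rewrite flow_saturated; apply/eqP; rewrite eq_le; apply/andP; split.
  have := min_capacity_le s (Ordinal lt_last); rewrite cap /lanes /=.
  by rewrite ltnNge -ltnS prednK ?ncells_gt0 // -addn1 leq_add2l mb_gt0.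
have [i ->] := min_capacity_attained s hp.
rewrite cap ler_pM2l ?vbar_gt0 // ler_pM2r //.
by rewrite /lanes; case: ifP => // _; rewrite ler_nat ltnW.
Qed.

Lemma flow_gt0 : 0 < q.
Proof. by rewrite flow_saturated (min_capacity_gt0 hp heq.1). Qed.

(** Below capacity, sending q means having the density q / vbar.  A cell whose
    capacity is q could have any density from the critical one upwards, but it
    also has to receive q, its full capacity, so it is not congested: this pins
    its density to the critical one, again q / vbar. *)
Lemma free_latency (i : cell) :
  sending s i = q -> dens s i / flow s i = (vbar p)^-1.
Proof.
move=> Si; suff vn : vbar p * dens s i = q.
  have := flow_gt0; rewrite flow_q -vn => /lt0r_neq0.
  rewrite mulf_eq0 negb_or => /andP[v0 n0].
  by field; rewrite v0 n0.
have [lt_cap|] := ltP q (capacity i (autonomy s i)).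
  have := sending_lt_capacity hp (s := s) (i := i).
  by rewrite Si => /(_ lt_cap) [].
move=> cap_le; apply: le_anti; apply/andP; split; last first.
  by rewrite -Si ge_min lexx orbT.
have q_cap : q = capacity i (autonomy s i).
  by apply: le_anti; rewrite cap_le -Si sending_le_capacity.
rewrite q_cap ler_pM2l ?vbar_gt0 // leNgt.
rewrite -[X in ~~ X]/(congested s i) -receiving_lt_capacity // -leNgt -q_cap.
exact: flow_le_receiving demand_neq0.
Qed.

(** A cell with sending function other than q could send more than q,
    that is, more than the capacity of a bottleneck cell. *)
Lemma queued_nonbottleneck (i : cell) : sending s i != q -> (i < m_n p)%N.
Proof.
apply: contraNT => n_lt; apply/eqP/le_anti.
rewrite flow_le_sending andbT (le_trans (sending_le_capacity _ _)) //.
by rewrite flow_bottleneck autonomy_alpha /capacity /crit /lanes (negPf n_lt).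
Qed.

(** Such a cell receives q below its capacity, so its density solves
    (jam - n) w = q.  With q = r * capacity this gives
    n = (1 - r) jam + r crit, where r crit = q / vbar is the free-flow
    density. *)
Lemma queued_latency (i : cell) : sending s i != q ->
  dens s i / flow s i = (vbar p)^-1 + queue_delay.
Proof.
have [_ /andP[b_gt0 b_lt] v_gt0 _ /(_ i _ alpha_itv) crit_lt] := hp.
move=> neq_S; have i_lt := queued_nonbottleneck neq_S.
have [/eqP|] := cell_on_diagram i; first by rewrite (negPf neq_S).
rewrite flow_q; have := flow_gt0; have := flow_bottleneck.
have := mean_headway_gt0 hp alpha_itv.
move: crit_lt; rewrite /receiving /capacity /shockwave autonomy_alpha.
rewrite /crit /lanes /jam i_lt /queue_delay /lane_ratio.
move: b_gt0 b_lt; rewrite -(ltr0n R) -(ltr_nat R).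
move: (mean_headway p alpha) (jam_n p) => h nj.
move: (lanes_n p)%:R (lanes_b p)%:R (dens s i) (vbar p) v_gt0.
move=> bn bb n v v_gt0 bb_gt0 bb_lt crit_lt h_gt0 q_eq q_gt0.
have bn_gt0 := lt_trans bb_gt0 bb_lt.
have lt_cap : q < v * (bn / h).
  by rewrite q_eq ltr_pM2l // ltr_pM2r // invr_gt0.
rewrite minEle; case: ifP => [_ cap_q|_ Rq].
  by move: lt_cap; rewrite cap_q ltxx.
(* Here bb / h is the free-flow density q / v. *)
have n_eq : n = nj * (1 - bb / bn) + bb / h.
  have d0 : nj * h - bn != 0.
    by rewrite gt_eqF // subr_gt0 -ltr_pdivrMr.
  have := lt0r_neq0 h_gt0; have := lt0r_neq0 bn_gt0; have := lt0r_neq0 v_gt0.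
  move=> v0 bn0 h0.
  have : (nj - n) = q * (nj - bn / h) / (v * (bn / h)).
    by rewrite -Rq; field; rewrite h0 bn0 v0 d0.
  rewrite q_eq => e; rewrite -[n](subKr nj) e.
  by field; rewrite ?v0 ?bn0 ?h0.
rewrite n_eq q_eq; field.
by rewrite !lt0r_neq0.
Qed.

Lemma saturated_latency : exists2 gamma : nat, (gamma <= m_n p)%N &
  latency s = (ncells p)%:R / vbar p + gamma%:R * queue_delay.
Proof.
exists #|[pred i | sending s i != q]|.
  (* Queued cells lie among the first m_n cells of the m_n + m_b. *)
  apply: (@leq_trans #|[pred i : cell | (i < m_n p)%N]|).
    apply/subset_leq_card/subsetP => i; rewrite !inE.
    exact: queued_nonbottleneck.
  rewrite -sum1_card big_split_ord /= addnC big_pred0 => [|j]; last first.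
    by rewrite inE /= ltnNge leq_addr.
  by rewrite sum1_card (leq_trans (max_card _)) // card_ord.
rewrite /latency (eq_bigr (fun i =>
  (vbar p)^-1 + (if sending s i != q then queue_delay else 0)))
  => [|i _]; last first.
  case: ifPn => [/queued_latency //|/negPn/eqP/free_latency ->].
  by rewrite addr0.
by rewrite big_split -big_mkcond /= !sumr_const card_ord !mulr_natl.
Qed.

End Saturated.
End Equilibrium.

Theorem theorem1 (R : realFieldType) (p : bpath R) (d_h d_a : R) (s : state p)
  (hp : valid_path p) (hdh : 0 <= d_h) (hda : 0 <= d_a)
  (heq : path_equilibrium d_h d_a s) :
  exists alpha : R,
    [/\ forall i : 'I_(ncells p), autonomy s i = alpha,
        d_h + d_a < min_capacity s ->
          forall i : 'I_(ncells p), ~~ congested s i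
      & min_capacity s <= d_h + d_a ->
        (d_h + d_a = min_capacity s -> on_fundamental_diagram s) ->
          exists2 gamma : nat, (gamma <= m_n p)%N &
            latency s = (ncells p)%:R / vbar p
              + gamma%:R
                * ((1 - lane_ratio p) * jam_n p * mean_headway p alpha
                   / (lane_ratio p * vbar p * (lanes_n p)%:R))].
Proof.
have [q flow_q] := flow_const hp heq.
pose alpha := autonomy s (Ordinal (ncells_gt0 hp)).
have autonomy_alpha i : autonomy s i = alpha.
  exact: (autonomy_const hp heq flow_q).
exists alpha; split=> [//|lt_d|le_d diagram].
- exact: (light_demand hp heq flow_q lt_d).
- exact: (saturated_latency hp heq flow_q le_d diagram autonomy_alpha).
Qed.
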